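(* Let $\mathcal{C}$ be a class of groups with associated invariant length functions, and suppose that, for all $(J,\ell_J)\in\mathcal{C}$ and all finite groups $X$, the pair $(J\wr X,\ell_J^X)$ is in $\mathcal{C}$. Suppose that the group $G$ is $\mathcal{C}$-approximable and the group $H$ is residually finite. Then the restricted standard wreath product $G\wr H$ is $\mathcal{C}$-approximable.
   Context: An invariant length function on a group $K$ is a map $\ell:K\to[0,1]$ such that for all $x,y\in K$: $\ell(x)=0 \iff x=1$; $\ell(x^{-1})=\ell(x)$; $\ell(xy)\le \ell(x)+\ell(y)$; $\ell(xyx^{-1})=\ell(y)$. A class $\mathcal{C}$ of groups with associated invariant length functions is a collection of pairs $(K,\ell_K)$, where $K$ is a group and $\ell_K$ an invariant length function on $K$ (the same group may occur with several length functions). A weight function for a group $G$ is a map $\delta:G\to\mathbb{R}$, $g\mapsto\delta_g$, with $\delta_1=0$ and $\delta_g>0$ for all $1\neq g\in G$. Given a group $G$ with weight function $\delta$, a group $K$ with invariant length function $\ell_K$, $\epsilon>0$ and a finite subset $F\subseteq G$, a map $\phi:G\to K$ is an $(F,\epsilon,\delta,\ell_K)$-quasi-homomorphism if: $\phi(1)=1$; $\ell_K(\phi(gh)\phi(h)^{-1}\phi(g)^{-1})\le\epsilon$ for all $g,h\in F$; and $\ell_K(\phi(g))\ge\delta_g$ for all $g\in F\setminus\{1\}$. A group $G$ is $\mathcal{C}$-approximable if it has a weight function $\delta$ such that, for each $\epsilon>0$ and each finite subset $F$ of $G$, there exists an $(F,\epsilon,\delta,\ell_K)$-quasi-homomorphism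 $\phi:G\to K$ for some $(K,\ell_K)\in\mathcal{C}$. The restricted standard wreath product $G\wr H$ is the semidirect product $H\ltimes B$, where the base group $B$ is the group of all functions $b:H\to G$ with finite support under pointwise multiplication, and $H$ acts on $B$ on the right by $b^h(h')=b(h'h^{-1})$. Elements are written $hb$ ($h\in H$, $b\in B$), with $(h_1b_1)(h_2b_2)=h_1h_2\,b_1^{h_2}b_2$. For a group $J$ with invariant length function $\ell_J$ and a finite group $X$, let $B'$ be the base group of $J\wr X$. The invariant length function $\ell_J^X:J\wr X\to[0,1]$ is defined by $\ell_J^X(b')=\max_{x\in X}\ell_J(b'(x))$ for $b'\in B'$, and $\ell_J^X(xb')=1$ for $1\ne x\in X$, $b'\in B'$. *)

(* Defs.v *)
From HB Require Import structures.
From mathcomp Require Import all_boot all_order all_algebra all_fingroup.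
From mathcomp Require Import finmap reals.

Set Implicit Arguments.
Unset Strict Implicit.
Unset Printing Implicit Defensive.

Import Order.TTheory GRing.Theory Num.Theory.
Local Open Scope fset_scope.
Local Open Scope ring_scope.

Record invariant_length (R : realType) (K : groupType) (l : K -> R) : Prop := {
  length_itv : forall x, 0 <= l x <= 1;
  length_eq0 : forall x, l x = 0 <-> x = 1%g;
  lengthV : forall x, l x^-1%g = l x;
  lengthM : forall x y, l (x * y)%g <= l x + l y;
  lengthJ : forall x y, l (x * y * x^-1)%g = l y }.

(* A collection of pairs (K, l) is given by its membership predicate. *)
Definition length_collection (R : realType) : Type :=
  forall K : groupType, (K -> R) -> Prop.

Definition length_class (R : realType) (C : length_collection R) : Prop :=
  forall (K : groupType) (l : K -> R), C K l -> invariant_length l.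

Definition weight_function (R : realType) (G : groupType) (delta : G -> R) :
  Prop := delta 1%g = 0 /\ forall g, g != 1%g -> 0 < delta g.

Record quasi_hom (R : realType) (G K : groupType) (F : {fset G}) (eps : R)
    (delta : G -> R) (l : K -> R) (phi : G -> K) : Prop := {
  quasi_hom1 : phi 1%g = 1%g;
  quasi_homM : forall g h, g \in F -> h \in F ->
    l (phi (g * h) * (phi h)^-1 * (phi g)^-1)%g <= eps;
  quasi_hom_ge : forall g, g \in F -> g != 1%g -> delta g <= l (phi g) }.

Definition approximable (R : realType) (C : length_collection R)
    (G : groupType) : Prop :=
  exists delta : G -> R, weight_function delta /\
    forall (eps : R) (F : {fset G}), 0 < eps ->
      exists (K : groupType) (l : K -> R),
        C K l /\ exists phi : G -> K, quasi_hom F eps delta l phi.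

Definition residually_finite (H : groupType) : Prop :=
  forall h : H, h != 1%g ->
    exists (Q : finGroupType) (f : {multiplicative H -> Q}), f h != 1%g.

Section Base.
Variables G H : groupType.
Local Open Scope group_scope.

Definition wreath_base := {fsfun H -> G with 1}.

HB.instance Definition _ := Choice.on wreath_base.

Implicit Types b c : wreath_base.

Definition base_one : wreath_base := [fsfun with 1].

Definition base_mul b c : wreath_base :=
  [fsfun h in finsupp b `|` finsupp c => b h * c h | 1].

Definition base_inv b : wreath_base := [fsfun h in finsupp b => (b h)^-1 | 1].

Definition base_act b (h : H) : wreath_base :=
  [fsfun k in [fset s * h | s in finsupp b] => b (k * h^-1) | 1].

Lemma base_oneE h : base_one h = 1. Proof. by rewrite fsfun0E. Qed.

Lemma base_mulE b c h : base_mul b c h = b h * c h.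
Proof.
rewrite fsfunE in_fsetU; case: (finsuppP b h) => //= _.
by case: (finsuppP c h) => //= _; rewrite mulg1.
Qed.

Lemma base_invE b h : base_inv b h = (b h)^-1.
Proof. by rewrite fsfunE; case: (finsuppP b h) => //= _; rewrite invg1. Qed.

Lemma base_actE b h k : base_act b h k = b (k * h^-1).
Proof.
rewrite fsfunE; case: ifPn => // kNb; rewrite [RHS]fsfun_dflt//.
apply: contra kNb => kb; apply/imfsetP; exists (k * h^-1) => //.
by rewrite -mulgA mulVg mulg1.
Qed.

Let base_mulA : associative base_mul.
Proof. by move=> b c d; apply/fsfunP => h; rewrite !base_mulE mulgA. Qed.
Let base_mul1 : left_id base_one base_mul.
Proof. by move=> b; apply/fsfunP => h; rewrite base_mulE base_oneE mul1g. Qed.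
Let base_mulr1 : right_id base_one base_mul.
Proof. by move=> b; apply/fsfunP => h; rewrite base_mulE base_oneE mulg1. Qed.
Let base_mulV : left_inverse base_one base_inv base_mul.
Proof.
by move=> b; apply/fsfunP => h; rewrite base_mulE base_invE base_oneE mulVg.
Qed.
Let base_mulrV : right_inverse base_one base_inv base_mul.
Proof.
by move=> b; apply/fsfunP => h; rewrite base_mulE base_invE base_oneE mulgV.
Qed.

HB.instance Definition _ := isGroup.Build wreath_base
  base_mulA base_mul1 base_mulr1 base_mulV base_mulrV.

Lemma base_act1 b : base_act b 1 = b.
Proof. by apply/fsfunP => h; rewrite base_actE invg1 mulg1. Qed.

Lemma base_actA b h k : base_act (base_act b h) k = base_act b (h * k).
Proof. by apply/fsfunP => x; rewrite !base_actE invgM mulgA. Qed.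

Lemma base_actM b c h : base_act (b * c) h = base_act b h * base_act c h.
Proof. by apply/fsfunP => k; rewrite base_actE !base_mulE !base_actE. Qed.

Lemma base_act_one h : base_act 1 h = 1.
Proof. by apply/fsfunP => k; rewrite base_actE !base_oneE. Qed.

End Base.

(* [Wreath h b] stands for the element [h b] of the semidirect product. *)
Record wreath (G H : groupType) := Wreath {
  wreath_top : H;
  wreath_fun : wreath_base G H }.

Section Wreath.
Variables G H : groupType.
Local Open Scope group_scope.

Let wreath_pair (w : wreath G H) := (wreath_top w, wreath_fun w).
Let pair_wreath (p : H * wreath_base G H) := Wreath p.1 p.2.
Let wreath_pairK : cancel wreath_pair pair_wreath. Proof. by case. Qed.

HB.instance Definition _ := Choice.copy (wreath G H) (can_type wreath_pairK).

Implicit Types u v w : wreath G H.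

Definition wreath_one : wreath G H := Wreath 1 1.

Definition wreath_mul u v : wreath G H :=
  Wreath (wreath_top u * wreath_top v)
         (base_act (wreath_fun u) (wreath_top v) * wreath_fun v).

Definition wreath_inv u : wreath G H :=
  Wreath (wreath_top u)^-1 (base_act (wreath_fun u)^-1 (wreath_top u)^-1).

Let wreath_mulA : associative wreath_mul.
Proof.
by move=> u v w; rewrite /wreath_mul /= base_actM base_actA !mulgA.
Qed.
Let wreath_mul1 : left_id wreath_one wreath_mul.
Proof. by case=> h b; rewrite /wreath_mul /= base_act_one !mul1g. Qed.
Let wreath_mulr1 : right_id wreath_one wreath_mul.
Proof. by case=> h b; rewrite /wreath_mul /= base_act1 !mulg1. Qed.
Let wreath_mulV : left_inverse wreath_one wreath_inv wreath_mul.
Proof.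
by case=> h b; rewrite /wreath_mul /= base_actA !mulVg base_act1 mulVg.
Qed.
Let wreath_mulrV : right_inverse wreath_one wreath_inv wreath_mul.
Proof.
by case=> h b; rewrite /wreath_mul /= -base_actM !mulgV base_act_one.
Qed.

HB.instance Definition _ := isGroup.Build (wreath G H)
  wreath_mulA wreath_mul1 wreath_mulr1 wreath_mulV wreath_mulrV.

End Wreath.

(* The neutral element 0 of the maximum is harmless: [X] is nonempty and
   lengths are nonnegative. *)
Definition wreath_length (R : realType) (J : groupType) (X : finGroupType)
    (l : J -> R) (w : wreath J X) : R :=
  if wreath_top w == 1%g then \big[Num.max/0]_(x : X) l (wreath_fun w x)
  else 1.

(* Main.v *)
Require Import Defs.
From HB Require Import structures.
From mathcomp Require Import all_boot all_order all_algebra all_fingroup.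
From mathcomp Require Import finmap reals.

(** The proof passes from H to a finite quotient X of H, and then from G to an
    approximating group K, in two independent steps.

    Finite top group.  Let F be a finite subset of the wreath product of G by
    X.  If psi : G -> K is a quasi-homomorphism on a finite subset of G
    containing all the values of the base parts of F, then applying psi to
    every value of the base part is a quasi-homomorphism on F to the wreath
    product of K by X.  Tops are kept unchanged, so the defect of a pair lies
    in the base group of the latter, and the value of this defect at each
    point, up to reindexing by X, is the defect of psi at a pair of values;
    the maximum over X is therefore still at most eps
    ([wreath_finite_approximable]).

    Change of top group.  Given a finite subset F of the wreath product of G
    by H, residual finiteness yields a morphism f from H to a finite group X
    that does not kill the nontrivial tops occurring in F and is injective on
    a finite subset S of H, where S contains the supports of the elements of F
    and their translates by the tops of F.  Moving functions from S to f(S)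
    and applying f to tops is then an exact homomorphism on F, although it
    need not be one globally ([wreath_local_embedding]).

    What makes the two steps compose is that the weight chosen on a wreath
    product ([wreath_weight]) is defined in the same way for every top group,
    and does not decrease along the local embedding. *)

Set Implicit Arguments.
Unset Strict Implicit.
Unset Printing Implicit Defensive.

Import Order.TTheory GRing.Theory Num.Theory.
Local Open Scope fset_scope.
Local Open Scope ring_scope.

(** * Morphisms to finite groups *)

Lemma multiplicative1 (G H : groupType) (f : {multiplicative G -> H}) :
  f 1%g = 1%g.
Proof. by apply: (mulgI (f 1%g)); rewrite -gmulfM !mulg1. Qed.

Lemma multiplicativeV (G H : groupType) (f : {multiplicative G -> H}) x :
  f x^-1%g = (f x)^-1%g.
Proof. by apply: (mulgI (f x)); rewrite -gmulfM !mulgV multiplicative1. Qed.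

Section PairMorphism.
Variables (H : groupType) (P Q : finGroupType).
Variables (f : {multiplicative H -> P}) (g : {multiplicative H -> Q}).

Definition pair_morph (h : H) : P * Q := (f h, g h).

Let pair_morphM : {morph pair_morph : x y / (x * y)%g}.
Proof. by move=> x y; rewrite /pair_morph !gmulfM. Qed.

HB.instance Definition _ :=
  isMultiplicative.Build H (P * Q)%type pair_morph pair_morphM.

End PairMorphism.

(** Finite groups are closed under products, so the quotients that separate
    the single elements of s from 1 can be combined into one. *)
Lemma residually_finite_seq (H : groupType) (s : seq H) :
  residually_finite H ->
  exists (Q : finGroupType) (f : {multiplicative H -> Q}),
    forall h, h \in s -> h != 1%g -> f h != 1%g.
Proof.
move=> resH; elim: s => [|k s [Q [f fP]]]; first by exists 'I_1, (one_fun _).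
have [->|/resH[P [g gk]]] := eqVneq k 1%g.
  by exists Q, f => h; rewrite inE => /predU1P[->|/fP//]; rewrite eqxx.
exists (P * Q)%type, (pair_morph g f) => h; rewrite inE.
rewrite /pair_morph /= xpair_eqE negb_and => /predU1P[->|hs] h1.
  by rewrite gk.
by rewrite fP ?orbT.
Qed.

(** * Approximation when the top group is finite *)

Section WreathBasics.
Variables (G H : groupType).
Implicit Types (b c : wreath_base G H) (u v w : wreath G H).
Local Open Scope group_scope.

Lemma wreath_base1E h : (1 : wreath_base G H) h = 1.
Proof. exact: base_oneE. Qed.

Lemma wreath_baseME b c h : (b * c) h = b h * c h.
Proof. exact: base_mulE. Qed.

Lemma wreath_baseVE b h : b^-1 h = (b h)^-1.
Proof. exact: base_invE. Qed.

Lemma wreath_eq u v :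
  wreath_top u = wreath_top v -> wreath_fun u = wreath_fun v -> u = v.
Proof. by case: u v => [h b] [k c] /= -> ->. Qed.

Lemma wreath_funME u v h : wreath_fun (u * v) h =
  wreath_fun u (h * (wreath_top v)^-1) * wreath_fun v h.
Proof. by rewrite wreath_baseME base_actE. Qed.

Lemma wreath_fun_divE u v h : wreath_fun (u * v^-1) h =
  wreath_fun u (h * wreath_top v) * (wreath_fun v (h * wreath_top v))^-1.
Proof. by rewrite wreath_funME /= invgK base_actE wreath_baseVE invgK. Qed.

End WreathBasics.

(** Among the possible weights this one is matched to [wreath_length]: an
    element with nontrivial top has length exactly 1, and an element of the
    base group has the largest length among its values. *)
Definition wreath_weight (R : realType) (G H : groupType) (delta : G -> R)
    (w : wreath G H) : R :=
  if wreath_top w == 1%g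
  then \big[Num.max/0]_(h <- finsupp (wreath_fun w)) delta (wreath_fun w h)
  else 1.

Lemma wreath_weightP (R : realType) (G H : groupType) (delta : G -> R) :
  weight_function delta -> weight_function (@wreath_weight R G H delta).
Proof.
move=> [delta1 delta_gt0]; split.
  rewrite /wreath_weight /= eqxx.
  rewrite big_seq big_pred0 // => h; apply/negbTE.
  by rewrite memNfinsupp; apply/eqP; exact: wreath_base1E.
move=> w w1; rewrite /wreath_weight; case: eqP => [tw|_]; last exact: ltr01.
have [b0|[h hb]] := fset_0Vmem (finsupp (wreath_fun w)).
  case/eqP: w1; apply: wreath_eq => //; apply/fsfunP => h.
  by rewrite wreath_base1E fsfun_dflt ?b0.
apply: (lt_le_trans (y := delta (wreath_fun w h))); last first.
  exact: le_bigmax_seq.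
apply: delta_gt0.
by rewrite mem_finsupp in hb.
Qed.

(** The inner part of [approximable], with the weight function made explicit:
    the weight on a wreath product has to be known in order to compare it
    across different top groups. *)
Definition approximable_for (R : realType) (C : length_collection R)
    (G : groupType) (delta : G -> R) : Prop :=
  forall (eps : R) (F : {fset G}), 0 < eps ->
    exists (K : groupType) (l : K -> R),
      C K l /\ exists phi : G -> K, quasi_hom F eps delta l phi.

Section MapWreath.
Variables (G K : groupType) (psi : G -> K).

Definition map_wreath (H : groupType) (w : wreath G H) : wreath K H :=
  Wreath (wreath_top w)
    [fsfun h in finsupp (wreath_fun w) => psi (wreath_fun w h) | 1%g].

Hypothesis psi1 : psi 1%g = 1%g.

Lemma map_wreathE (H : groupType) (w : wreath G H) h :
  wreath_fun (map_wreath w) h = psi (wreath_fun w h).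
Proof. by rewrite fsfunE; case: finsuppP => // _; rewrite psi1. Qed.

End MapWreath.

(** When the tops agree, u v^-1 lies in the base group, and conjugation by the
    common top only permutes its values: the maximum over X does not see it. *)
Lemma wreath_length_div (R : realType) (K : groupType) (X : finGroupType)
    (l : K -> R) (eps : R) (u v : wreath K X) :
  0 <= eps -> wreath_top u = wreath_top v ->
  (forall x, l (wreath_fun u x * (wreath_fun v x)^-1)%g <= eps) ->
  wreath_length l (u * v^-1)%g <= eps.
Proof.
move=> eps0 tuv luv; rewrite /wreath_length /= tuv mulgV eqxx.
by apply: bigmax_le => // x _; rewrite wreath_fun_divE.
Qed.

(** F0 contains every value of the base parts, hence also the two arguments
    that a product in F brings together at a point, one of which has been
    translated. *)
Lemma map_wreath_quasi_hom (R : realType) (G K : groupType) (X : finGroupType)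
    (F0 : {fset G}) (F : {fset wreath G X}) (eps : R) (delta : G -> R)
    (l : K -> R) (psi : G -> K) :
  (forall w x, w \in F -> wreath_fun w x \in F0) -> 0 <= eps ->
  quasi_hom F0 eps delta l psi ->
  quasi_hom F eps (wreath_weight delta) (wreath_length (X := X) l)
    (map_wreath psi (H := X)).
Proof.
move=> FF0 eps0 [psi1 psiM psi_ge]; split.
- apply: wreath_eq => //; apply/fsfunP => x.
  by rewrite map_wreathE // !wreath_base1E.
- move=> u v uF vF.
  (* The defect is the quotient of the image of u v by the product of the
     images, two elements with the same top. *)
  rewrite -mulgA -invgM.
  apply: wreath_length_div => // x; rewrite wreath_funME !map_wreathE //.
  by rewrite wreath_funME invgM mulgA psiM ?FF0.
- move=> w wF _; rewrite /wreath_weight /wreath_length /=; case: ifP => // _.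
  rewrite big_seq; apply: bigmax_le => [|x].
    exact: bigmax_ge_id.
  rewrite mem_finsupp => wx; apply: (bigmax_sup x) => //.
  by rewrite map_wreathE // psi_ge ?FF0.
Qed.

Lemma wreath_finite_approximable (R : realType) (C : length_collection R)
    (C_wreath : forall (J : groupType) (lJ : J -> R), C J lJ ->
       forall X : finGroupType, C (wreath J X) (wreath_length (X := X) lJ))
    (G : groupType) (X : finGroupType) (delta : G -> R) :
  approximable_for C delta ->
  approximable_for C (@wreath_weight R G X delta).
Proof.
move=> Gdelta eps F eps0.
pose F0 := \bigcup_(w <- F) [fset wreath_fun w x | x in X].
have [K [l [CKl [psi psiP]]]] := Gdelta eps F0 eps0.
exists (wreath K X), (wreath_length (X := X) l); split; first exact: C_wreath.
exists (map_wreath psi (H := X)).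
apply: map_wreath_quasi_hom psiP; last exact: ltW.
move=> w x wF; apply/bigfcupP; exists w; first by rewrite wF.
by apply/imfsetP; exists x.
Qed.

(** * Moving finitely supported functions along a locally injective morphism *)

Section Transport.
Variables (G H X : groupType) (f : {multiplicative H -> X}) (S : {fset H}).
Implicit Types b c : wreath_base G H.
Local Open Scope group_scope.

(** A section of f over f(S); the default value 1 is taken outside f(S). *)
Definition fiber_rep (x : X) : H := head 1 [seq s <- S | f s == x].

Lemma fiber_repP x : x \in [fset f s | s in S] ->
  fiber_rep x \in S /\ f (fiber_rep x) = x.
Proof.
case/imfsetP => s /= sS ->; rewrite /fiber_rep.
have: s \in [seq t <- S | f t == f s] by rewrite mem_filter eqxx.
case E: [seq _ <- _ | _] => [//|t r] _ /=.
have: t \in t :: r by rewrite mem_head.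
by rewrite -E mem_filter => /andP[/eqP].
Qed.

Definition transport b : wreath_base G X :=
  [fsfun x in [fset f s | s in S] => b (fiber_rep x) | 1].

Lemma transport_eq1 b x :
  (forall s, s \in S -> f s = x -> b s = 1) -> transport b x = 1.
Proof. by move=> bx; rewrite fsfunE; case: ifP => // /fiber_repP[/bx]. Qed.

Lemma transport1 : transport 1 = 1.
Proof.
apply/fsfunP => x; rewrite wreath_base1E transport_eq1 // => s _ _.
exact: wreath_base1E.
Qed.

Lemma transportM b c : transport (b * c) = transport b * transport c.
Proof.
apply/fsfunP => x; rewrite [RHS]wreath_baseME [LHS]fsfunE wreath_baseME.
rewrite [transport b x]fsfunE [transport c x]fsfunE.
by case: ifP => // _; rewrite mulg1.
Qed.

Hypothesis f_inj : {in S &, injective f}.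

Lemma transportE b s : s \in S -> transport b (f s) = b s.
Proof.
move=> sS; have fsS : f s \in [fset f s | s in S] by apply/imfsetP; exists s.
rewrite fsfunE fsS; have [rS fr] := fiber_repP fsS.
by congr (b _); apply: f_inj.
Qed.

(** Both sides are trivial at x unless x = f (t h) for some t in the support
    of b, and then both equal b t, because f is injective on a set containing
    t and t h.  Without the condition on translates the left side could forget
    a value that is moved out of S. *)
Lemma transport_act b h :
  finsupp b `<=` S -> (forall s, s \in finsupp b -> s * h \in S) ->
  transport (base_act b h) = base_act (transport b) (f h).
Proof.
move=> /fsubsetP bS bhS; apply/fsfunP => x; rewrite base_actE.
have [xfb|xNfb] := boolP (x * (f h)^-1 \in [fset f t | t in finsupp b]).
  have [t /= tb xt] := imfsetP _ _ _ _ xfb.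
  have -> : x = f (t * h) by rewrite gmulfM -xt -mulgA mulVg mulg1.
  rewrite transportE ?bhS // base_actE gmulfM -!mulgA !mulgV !mulg1.
  by rewrite transportE ?bS.
have b1 t : f t = x * (f h)^-1 -> b t = 1.
  move=> ft; apply: fsfun_dflt; apply: contra xNfb => tb.
  by apply/imfsetP; exists t.
rewrite !transport_eq1 // => s _ fs; first exact: b1.
by rewrite base_actE b1 // gmulfM multiplicativeV fs.
Qed.

End Transport.

(** * Local embedding into a wreath product with finite top group *)

(** The inequality of weights is a quantitative form of injectivity: for a
    weight function delta it implies that theta maps no nontrivial element of
    F to 1. *)
Lemma wreath_local_embedding (R : realType) (G H : groupType)
    (F : {fset wreath G H}) :
  residually_finite H ->
  exists (X : finGroupType) (theta : wreath G H -> wreath G X),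
    [/\ theta 1%g = 1%g,
        {in F &, {morph theta : u v / (u * v)%g}} &
        forall (delta : G -> R) w, w \in F ->
          wreath_weight delta w <= wreath_weight delta (theta w)].
Proof.
move=> resH.
pose B := \bigcup_(w <- F) finsupp (wreath_fun w).
pose T := [fset wreath_top w | w in F].
pose S := B `|` [fset (s * t)%g | s in B, t in T].
(* Separating s from t amounts to not killing s t^-1. *)
have [X [f fP]] := residually_finite_seq
  ([seq (s * t^-1)%g | s <- S, t <- S] ++ T) resH.
have f_inj : {in S &, injective f}.
  move=> s t sS tS fst; apply/eqP; rewrite -(inj_eq (mulIg t^-1%g)) mulgV.
  apply/negPn/negP => /fP; rewrite mem_cat.
  rewrite (allpairs_f (fun s t => s * t^-1)%g) // => /(_ isT).
  by rewrite gmulfM multiplicativeV fst mulgV eqxx.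
have fT w : w \in F -> (f (wreath_top w) == 1%g) = (wreath_top w == 1%g).
  move=> wF; apply/eqP/eqP => [fw|->]; last exact: multiplicative1.
  apply/eqP; apply: contraTT isT => w1; move: (fP (wreath_top w)).
  rewrite mem_cat fw eqxx => /(_ _ w1); apply.
  by apply/orP; right; apply/imfsetP; exists w.
have FB w s : w \in F -> s \in finsupp (wreath_fun w) -> s \in B.
  by move=> wF sw; apply/bigfcupP; exists w; rewrite ?wF.
have BS s : s \in B -> s \in S by move=> sB; rewrite in_fsetU sB.
pose theta (w : wreath G H) :=
  Wreath (f (wreath_top w)) (transport f S (wreath_fun w)).
have theta_weight (delta : G -> R) w : w \in F ->
    wreath_weight delta w <= wreath_weight delta (theta w).
  move=> wF; rewrite /wreath_weight /= fT //; case: ifP => // _.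
  rewrite big_seq; apply: bigmax_le => [|s sw]; first exact: bigmax_ge_id.
  have sS : s \in S by apply/BS/(FB w).
  apply: (bigmax_sup_seq _ (f s)) => //; last by rewrite transportE.
  by rewrite mem_finsupp transportE // -mem_finsupp.
exists X, theta; split => //.
- by apply: wreath_eq; rewrite /= ?multiplicative1 ?transport1.
- move=> u v uF vF; apply: wreath_eq; rewrite /= ?gmulfM // transportM.
  rewrite transport_act //.
    by apply/fsubsetP => s /(FB _ _ uF)/BS.
  move=> s /(FB _ _ uF) sB; rewrite in_fsetU; apply/orP; right.
  by apply/imfset2P; exists s => //; exists (wreath_top v) => //;
    apply/imfsetP; exists v.
Qed.

Theorem theorem3p1 (R : realType) (C : length_collection R)
    (C_length : length_class C)
    (C_wreath : forall (J : groupType) (lJ : J -> R), C J lJ ->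
       forall X : finGroupType, C (wreath J X) (wreath_length (X := X) lJ))
    (G H : groupType) (G_approx : approximable C G)
    (H_resfin : residually_finite H) :
  approximable C (wreath G H).
Proof.
have [delta [deltaP Gdelta]] := G_approx.
exists (wreath_weight delta); split; first exact: wreath_weightP.
move=> eps F eps0.
have [X [theta [theta1 thetaM theta_weight]]] :=
  wreath_local_embedding R F H_resfin.
have [W1 W_gt0] := wreath_weightP H deltaP.
have [W1' _] := wreath_weightP X deltaP.
have theta_neq1 w : w \in F -> w != 1%g -> theta w != 1%g.
  move=> wF w1; apply/eqP => thetaw; have := theta_weight delta w wF.
  by rewrite thetaw W1' leNgt W_gt0.
have thetaF w : w \in F -> theta w \in [fset theta w | w in F].
  by move=> wF; apply/imfsetP; exists w.
have [K [l [CKl [phi [phi1 phiM phi_ge]]]]] :=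
  wreath_finite_approximable C_wreath (X := X) Gdelta
    [fset theta w | w in F] eps0.
exists K, l; split=> //; exists (phi \o theta); split=> /=.
- by rewrite theta1.
- by move=> u v uF vF; rewrite thetaM // phiM ?thetaF.
- move=> w wF w1; apply: le_trans (theta_weight delta w wF) _.
  by rewrite phi_ge ?thetaF ?theta_neq1.
Qed.
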